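(* Let $n\ge1$. The map $\Omega:\mathsf{HBPD}(n)\to\mathsf{DT}(n-1)$ is a shape preserving bijection. Furthermore, if $\mathcal P\in\mathsf{HBPD}(n)$ lies in $\mathsf{Pipes}(w)$, then the column reading word of $\Omega(\mathcal P)$ is a Hecke word for $w$.
   Context: Bumpless pipe dreams. Cells $(i,j)$ of the $n\times n$ grid: row $i$ from the top, column $j$ from the left. There are six tiles: downward elbow (a pipe joining the bottom and right edges), upward elbow (a pipe joining the left and top edges), crossing (one pipe joining left and right edges and one joining bottom and top edges), blank (no pipe), horizontal (a pipe joining left and right edges), vertical (a pipe joining bottom and top edges). A bumpless pipe dream (BPD) of size $n$ is a tiling of the $n\times n$ grid by these tiles such that an edge shared by two cells is met by a pipe from both sides or from neither, every edge on the bottom and right boundaries of the grid is met by a pipe, and no edge on the left or top boundary is met by a pipe. $D(\mathcal P)$ is the set of positions of blank tiles of $\mathcal P$. Demazure product $\partial(\mathcal P)\in S_n$: label the bottom boundary edges $1,\dots,n$ from left to right and propagate labels along pipes north and east; at a crossing tile, of the two labels entering from the left and from below, the smaller leaves through the right edge and the larger through the top edge. $\partial(\mathcal P)(i)$ is the label arriving at the right boundary edge of row $i$. $\mathsf{Pipes}(w)=\{\mathcal P:\partial(\mathcal P)=w\}$. For a partition $\lambda$, $\mathbb Y(\lambda)=\{(i,j):1\le j\le\lambda_i\}$. A BPD $\mathcal P$ is Hecke, of shape $\lambda$, if $D(\mathcal P)=\mathbb Y(\lambda)$ for some partition $\lambda$. $\mathsf{HBPD}(n)$ is the set of Hecke BPDs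 of size $n$. A decreasing tableau of shape $\lambda$ is a function $\mathbb Y(\lambda)\to\{1,2,\dots\}$ whose values strictly decrease along rows (left to right) and down columns. $\mathsf{DT}(n-1)$ is the set of decreasing tableaux (of all partition shapes, including the empty one) with entries in $\{1,\dots,n-1\}$. The column reading word reads the entries along columns from bottom to top, taking the columns from left to right. Hecke words: in the Demazure algebra, the free $\mathbb Z$-module with basis $\{e_w:w\in S_n\}$ and product determined by $e_we_{s_i}=e_{ws_i}$ if $\ell(ws_i)>\ell(w)$ and $e_we_{s_i}=e_w$ otherwise ($s_i=(i\ i+1)$), a word $(a_1,\dots,a_k)$ with letters in $\{1,\dots,n-1\}$ is a Hecke word for $w$ if $e_{s_{a_1}}\cdots e_{s_{a_k}}=e_w$. The map $\Omega$: in each diagonal $\{(i,j):j-i=c\}$ of a BPD there are as many blank tiles as crossing tiles. Ordering each diagonal from northwest to southeast, pair the first blank tile with the last crossing tile, the second blank tile with the second-to-last crossing tile, and so on. For $\mathcal P\in\mathsf{HBPD}(n)$, $\Omega(\mathcal P)$ is the filling of $D(\mathcal P)$ in which a blank cell in row $i$ whose paired crossing tile is in row $i'$ receives the value $i'-i$. *)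

(* Defs.v *)
From HB Require Import structures.
From mathcomp Require Import all_boot all_order all_algebra all_fingroup.
From mathcomp Require Import finmap.

Set Implicit Arguments.
Unset Strict Implicit.
Unset Printing Implicit Defensive.

Import GRing.Theory.

(* All row, column and label indices are 0-based.  Tableau entries and the
   letters of Hecke words keep their usual values 1, ..., n-1. *)

Inductive tile := DownElbow | UpElbow | Crossing | Blank | Horizontal | Vertical.

Definition tile_eq_dec (t u : tile) : decidable (t = u).
Proof. by case: t; case: u; (by left) || (by right). Defined.

HB.instance Definition _ := hasDecEq.Build tile (compareP tile_eq_dec).

Definition meets_left (t : tile) : bool :=
  match t with UpElbow | Crossing | Horizontal => true | _ => false end.

Definition meets_right (t : tile) : bool :=
  match t with DownElbow | Crossing | Horizontal => true | _ => false end.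

Definition meets_top (t : tile) : bool :=
  match t with UpElbow | Crossing | Vertical => true | _ => false end.

Definition meets_bottom (t : tile) : bool :=
  match t with DownElbow | Crossing | Vertical => true | _ => false end.

Record is_bpd (n : nat) (P : 'M[tile]_n) : Prop := IsBPD {
  bpd_row_match : forall i j j' : 'I_n,
    j' = j.+1 :> nat -> meets_right (P i j) = meets_left (P i j');
  bpd_col_match : forall i i' j : 'I_n,
    i' = i.+1 :> nat -> meets_bottom (P i j) = meets_top (P i' j);
  bpd_bottom : forall i j : 'I_n, i.+1 = n -> meets_bottom (P i j);
  bpd_right : forall i j : 'I_n, j.+1 = n -> meets_right (P i j);
  bpd_left : forall i j : 'I_n, j = 0 :> nat -> ~~ meets_left (P i j);
  bpd_top : forall i j : 'I_n, i = 0 :> nat -> ~~ meets_top (P i j)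
}.

Definition blanks (n : nat) (P : 'M[tile]_n) : {fset nat * nat} :=
  [fset (val c.1, val c.2) | c : 'I_n * 'I_n & P c.1 c.2 == Blank]%fset.

(* [None] marks an edge that no pipe meets. *)
Definition edge_label (n : nat) := option 'I_n.

(* [l] and [b] label the left and bottom edges of a cell; the result is the
   pair of the labels of its right and top edges. *)
Definition tile_out (n : nat) (t : tile) (l b : edge_label n) :
    edge_label n * edge_label n :=
  match t with
  | DownElbow => (b, None)
  | UpElbow => (None, l)
  | Crossing =>
      match l, b with
      | Some x, Some y => if x < y then (Some x, Some y) else (Some y, Some x)
      | _, _ => (None, None)
      end
  | Blank => (None, None)
  | Horizontal => (l, None)
  | Vertical => (None, b)
  end.

(* [ts] and [ls] list the tiles and the left edge labels of one column from
   bottom to top, and [b] is the label entering from below; the result lists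
   the right edge labels of that column, again from bottom to top. *)
Fixpoint column_out (n : nat) (ts : seq tile) (ls : seq (edge_label n))
    (b : edge_label n) : seq (edge_label n) :=
  match ts, ls with
  | t :: ts', l :: ls' =>
      let: (r, u) := tile_out t l b in r :: column_out ts' ls' u
  | _, _ => [::]
  end.

(* The labels of the right boundary edges, from the top row to the bottom row. *)
Definition demazure_labels (n : nat) (P : 'M[tile]_n) : seq (edge_label n) :=
  rev (foldl
         (fun ls (j : 'I_n) =>
            column_out [seq P i j | i <- rev (enum 'I_n)] ls (Some j))
         (nseq n None) (enum 'I_n)).

Definition in_Pipes (n : nat) (w : 'S_n) (P : 'M[tile]_n) : Prop :=
  is_bpd P /\ demazure_labels P = [seq Some (w i) | i <- enum 'I_n].

(* Trailing zero parts are allowed. *)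
Definition is_partition (la : seq nat) : bool := sorted geq la.

Definition young (la : seq nat) : pred (nat * nat) :=
  fun c => c.2 < nth 0 la c.1.

Definition HBPD_of_shape (n : nat) (la : seq nat) (P : 'M[tile]_n) : Prop :=
  [/\ is_bpd P, is_partition la & blanks P =i young la].

Definition HBPD (n : nat) (P : 'M[tile]_n) : Prop :=
  exists la : seq nat, HBPD_of_shape la P.

Definition filling := {fmap nat * nat -> nat}.

Record dec_tableau_of_shape (la : seq nat) (T : filling) : Prop :=
  DecTableauOfShape {
  dt_partition : is_partition la;
  dt_domain : domf T =i young la;
  dt_pos : forall c x, T.[? c]%fmap = Some x -> 0 < x;
  dt_row : forall i j j' x x', j < j' ->
    T.[? (i, j)]%fmap = Some x -> T.[? (i, j')]%fmap = Some x' -> x' < x;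
  dt_col : forall i i' j x x', i < i' ->
    T.[? (i, j)]%fmap = Some x -> T.[? (i', j)]%fmap = Some x' -> x' < x
}.

Definition DT (m : nat) (T : filling) : Prop :=
  (exists la : seq nat, dec_tableau_of_shape la T) /\
  (forall c x, T.[? c]%fmap = Some x -> x <= m).

Definition column_le : rel (nat * nat) :=
  fun c c' => (c.2 < c'.2) || ((c.2 == c'.2) && (c'.1 <= c.1)).

Definition column_word (T : filling) : seq nat :=
  pmap (fun c => T.[? c]%fmap) (sort column_le (domf T)).

(* The rows, from northwest to southeast, of the tiles [t] on the diagonal
   [j - i = d]; a diagonal meets each row at most once, so a row determines a
   cell of the diagonal. *)
Definition diag_rows (n : nat) (P : 'M[tile]_n) (t : tile) (d : int) : seq nat :=
  [seq val i | i : 'I_n <- enum 'I_n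
     & [exists j : 'I_n, ((j%:Z - i%:Z)%R == d) && (P i j == t)]].

Definition paired_row (n : nat) (P : 'M[tile]_n) (c : nat * nat) : nat :=
  let d := (c.2%:Z - c.1%:Z)%R in
  nth 0 (rev (diag_rows P Crossing d)) (index c.1 (diag_rows P Blank d)).

(* The subtraction is truncated: a paired crossing weakly above the blank tile
   would give the entry 0, which is not allowed in a decreasing tableau. *)
Definition Omega (n : nat) (P : 'M[tile]_n) : filling :=
  [fmap c : blanks P => paired_row P (val c) - (val c).1].

Definition perm_length (n : nat) (w : 'S_n) : nat :=
  #|[set p : 'I_n * 'I_n | (p.1 < p.2) && (w p.2 < w p.1)]|.

(* The transposition (a a+1) of {1, ..., n}, hence of the 0-based indices
   [a.-1] and [a]; it is only meaningful for [0 < a < n]. *)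
Definition simple_transp (n : nat) (a : nat) : 'S_n :=
  match insub a.-1, insub a with
  | Some i, Some j => tperm i j
  | _, _ => 1%g
  end.

(* The product w s_a in which s_a acts first; MathComp composes permutations
   from left to right. *)
Definition mul_simple (n : nat) (w : 'S_n) (a : nat) : 'S_n :=
  (simple_transp n a * w)%g.

Definition demazure_algebra (n : nat) := {ffun 'S_n -> int}.

Definition demazure_basis (n : nat) (w : 'S_n) : demazure_algebra n :=
  [ffun u => (u == w)%:R%R].

(* The product e_w e_{s_a}. *)
Definition basis_mul_simple (n : nat) (w : 'S_n) (a : nat) : demazure_algebra n :=
  demazure_basis
    (if perm_length w < perm_length (mul_simple w a) then mul_simple w a else w).

(* Right multiplication by e_{s_a}, extended linearly. *)
Definition demazure_mul_simple (n : nat) (x : demazure_algebra n) (a : nat) :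
    demazure_algebra n :=
  (\sum_(w : 'S_n) basis_mul_simple w a *~ x w)%R.

(* The product e_{s_{a_1}} ... e_{s_{a_k}}, evaluated from the left starting
   from the unit e_1 of the algebra. *)
Definition demazure_word (n : nat) (a : seq nat) : demazure_algebra n :=
  foldl (@demazure_mul_simple n) (demazure_basis 1%g) a.

Definition hecke_word (n : nat) (w : 'S_n) (a : seq nat) : Prop :=
  all (fun x => 0 < x < n) a /\ demazure_word n a = demazure_basis w.

(* Main.v *)
Require Import Defs.
From mathcomp Require Import all_boot all_order all_algebra all_fingroup.
From mathcomp Require Import finmap.
From mathcomp Require Import zify.

Set Implicit Arguments.
Unset Strict Implicit.
Unset Printing Implicit Defensive.

(** Let r(i, j) be the number of pipes that cross the vertical grid line j within
    the first i rows.  A BPD is the same as a function r on the vertices of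
    the grid with unit or zero steps and the right boundary values; along a
    diagonal r increases by 0 at a blank, by 2 at a crossing and by 1 otherwise.
    For a Hecke BPD the tableau T = Omega(P), extended by 0, is characterised by
      k < T(a, b)  iff  r(a+k+1, b+k+1) <= k,
    and this equivalence translates "steps 0 or 1" into "T decreases".

    The crossing paired with the cell (a, b) lies at (a+T, b+T), where
    r = T - 1; it acts on the labels, listed by their position along a cut of
    the grid, as the Demazure operator of s_T.  Reading the crossings column by
    column from bottom to top thus gives a Hecke word, and it differs from the
    column reading word only by commutations. *)

(** * Corner functions *)

(** These are the corner sum matrices of alternating sign matrices: a downward elbow is an entry 1,
    an upward elbow an entry -1. *)
Record corner_sum (n : nat) (r : nat -> nat -> nat) : Prop := CornerSum {
  corner_left : forall i, i <= n -> r i 0 = 0;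
  corner_top : forall j, j <= n -> r 0 j = 0;
  corner_right : forall i, i <= n -> r i n = i;
  corner_bottom : forall j, j <= n -> r n j = j;
  corner_down : forall i j, i < n -> j <= n -> r i j <= r i.+1 j <= (r i j).+1;
  corner_step : forall i j, i <= n -> j < n -> r i j <= r i j.+1 <= (r i j).+1
}.

(** Kept as a relation, so that the same lemmas serve the function counted from a BPD and the one
    built from a tableau. *)
Definition corner_of (n : nat) (P : 'M[tile]_n) (r : nat -> nat -> nat) : Prop :=
  forall i j : 'I_n,
    [/\ meets_left (P i j) = (r i j < r i.+1 j),
        meets_right (P i j) = (r i j.+1 < r i.+1 j.+1),
        meets_top (P i j) = (r i j < r i j.+1)
      & meets_bottom (P i j) = (r i.+1 j < r i.+1 j.+1)].

(** Total, so that positions such as (a + k, b + k) carry no bound proofs. With [Blank] as default,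
    a crossing always lies in the grid. *)
Definition tile_at (n : nat) (P : 'M[tile]_n) (i j : nat) : tile :=
  if insub i is Some i' then if insub j is Some j' then P i' j' else Blank
  else Blank.

Lemma tile_atE n (P : 'M[tile]_n) (i j : 'I_n) : tile_at P i j = P i j.
Proof. by rewrite /tile_at !valK. Qed.

Definition right_edge (n : nat) (P : 'M[tile]_n) (i j : nat) : bool :=
  if j is j'.+1 then meets_right (tile_at P i j') else false.

Definition corner (n : nat) (P : 'M[tile]_n) (i j : nat) : nat :=
  \sum_(a < i) right_edge P a j.

Lemma cornerS n (P : 'M[tile]_n) i j :
  corner P i.+1 j = corner P i j + right_edge P i j.
Proof. by rewrite /corner big_ord_recr. Qed.

Lemma tile_flow t : meets_top t + meets_right t = meets_left t + meets_bottom t.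
Proof. by case: t. Qed.

Lemma meets_left_right_edge n (P : 'M[tile]_n) (i j : 'I_n) :
  is_bpd P -> meets_left (P i j) = right_edge P i j.
Proof.
move=> bP; case: j => -[|j] ltj /=; first by apply/negbTE/(bpd_left bP).
have ltj' : j < n by lia.
by rewrite -(bpd_row_match bP i (j := Ordinal ltj')) // -tile_atE.
Qed.

(** Flow through the first [i] cells of column [j]: nothing leaves through the top boundary, so the
    gain from line [j] to line [j + 1] is what enters from below. For [i = n] that edge is on the
    bottom boundary and always met, hence [true]. *)
Lemma corner_stepE n (P : 'M[tile]_n) (i j : nat) : is_bpd P -> i <= n -> j < n ->
  corner P i j.+1 =
  corner P i j + (if i < n then meets_top (tile_at P i j) else true).
Proof.
move=> bP; elim: i => [|i IHi] lti ltj.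
  have n0 : 0 < n by lia.
  rewrite /corner !big_ord0 n0.
  have /negbTE := bpd_top bP (i := Ordinal n0) (Ordinal ltj) erefl.
  by rewrite -tile_atE /= => ->.
pose i' := Ordinal lti; pose j' := Ordinal ltj.
rewrite !cornerS IHi ?(ltnW lti) // lti.
have := tile_flow (P i' j'); rewrite meets_left_right_edge // -tile_atE => /= E.
have -> : (if i.+1 < n then meets_top (tile_at P i.+1 j) else true)
   = meets_bottom (tile_at P i j).
  have [lti1|lein] := ltnP i.+1 n.
    by rewrite (tile_atE P i' j')  (bpd_col_match bP (i' := Ordinal lti1)) //
      -tile_atE.
  by rewrite (tile_atE P i' j') (bpd_bottom bP) //=; lia.
by rewrite -!addnA E.
Qed.

Lemma corner_sumP n (P : 'M[tile]_n) : is_bpd P -> corner_sum n (corner P).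
Proof.
move=> bP; have stepE i j := @corner_stepE n P i j bP.
have bottomE j : j <= n -> corner P n j = j.
  elim: j => [|j IHj] lej; last by rewrite stepE // ltnn IHj ?(ltnW lej) // addn1.
  by rewrite /corner big1.
split=> //.
- by move=> i _; rewrite /corner big1.
- by move=> j _; rewrite /corner big_ord0.
- elim=> [|i IHi] lei; first by rewrite /corner big_ord0.
  rewrite cornerS IHi ?(ltnW lei) // /right_edge.
  case: n {stepE bottomE IHi} P bP lei => // n P bP lei.
  by rewrite (tile_atE P (Ordinal lei) ord_max) (bpd_right bP) // addn1.
- by move=> i j _ _; rewrite cornerS; case: right_edge; lia.
- by move=> i j lei ltj; rewrite stepE //; case: (if _ then _ else _); lia.
Qed.

Lemma corner_ofP n (P : 'M[tile]_n) : is_bpd P -> corner_of P (corner P).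
Proof.
move=> bP i j.
have Er : right_edge P i j.+1 = meets_right (P i j) by rewrite /= tile_atE.
have Et := corner_stepE bP (ltnW (ltn_ord i)) (ltn_ord j).
rewrite ltn_ord tile_atE in Et.
have := tile_flow (P i j); rewrite meets_left_right_edge // => E.
split; rewrite -?Er ?cornerS ?Et -?Er; try by case: right_edge; lia.
- by case: meets_top; lia.
rewrite Er; move: E; case: meets_right; case: meets_top; case: meets_bottom;
  case: right_edge => //=; lia.
Qed.

Lemma corner_of_inj n (P Q : 'M[tile]_n) r :
  corner_of P r -> corner_of Q r -> P = Q.
Proof.
move=> cP cQ; apply/matrixP => i j; have [] := cP i j; have [] := cQ i j.
by move=> <- <- <- <-; case: (P i j); case: (Q i j).
Qed.

(** By conservation of pipes the left and bottom edges decide the tile when they agree; when they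
    differ, the top edge tells where the single pipe leaves. *)
Definition tile_of (r : nat -> nat -> nat) (i j : nat) : tile :=
  match r i j < r i.+1 j, r i.+1 j < r i.+1 j.+1, r i j < r i j.+1 with
  | false, false, _ => Blank
  | true, true, _ => Crossing
  | true, false, true => UpElbow
  | true, false, false => Horizontal
  | false, true, true => Vertical
  | false, true, false => DownElbow
  end.

Lemma corner_of_tile_of n r : corner_sum n r ->
  corner_of (\matrix_(i < n, j < n) tile_of r i j) r.
Proof.
move=> cr i j; rewrite mxE /tile_of.
have := corner_down cr (ltn_ord i) (ltnW (ltn_ord j)).
have := corner_down cr (ltn_ord i) (ltn_ord j).
have := corner_step cr (ltnW (ltn_ord i)) (ltn_ord j).
have := corner_step cr (ltn_ord i) (ltn_ord j).
case: (ltnP (r i j) (r i.+1 j)); case: (ltnP (r i.+1 j) (r i.+1 j.+1));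
  case: (ltnP (r i j) (r i j.+1)); split=> //=; lia.
Qed.

Lemma is_bpd_corner n (P : 'M[tile]_n) r :
  corner_sum n r -> corner_of P r -> is_bpd P.
Proof.
move=> cr cP; split.
- by move=> i j j' E; case: (cP i j) => _ -> _ _; case: (cP i j') => -> _ _ _; rewrite E.
- by move=> i i' j E; case: (cP i j) => _ _ _ ->; case: (cP i' j) => _ _ -> _; rewrite E.
- by move=> i j E; case: (cP i j) => _ _ _ ->; rewrite E !(corner_bottom cr) // ltnW.
- by move=> i j E; case: (cP i j) => _ -> _ _; rewrite E !(corner_right cr) // ltnW.
- by move=> i j E; case: (cP i j) => -> _ _ _; rewrite E !(corner_left cr) // ltnW.
- by move=> i j E; case: (cP i j) => _ _ -> _; rewrite E !(corner_top cr) // ltnW.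
Qed.

Section CornerFacts.
Variables (n : nat) (P : 'M[tile]_n) (r : nat -> nat -> nat).
Hypotheses (cr : corner_sum n r) (cP : corner_of P r).

Lemma corner_le i j : i <= n -> j <= n -> r i j <= minn i j.
Proof.
move=> lei lej; rewrite leq_min; apply/andP; split.
  elim: i lei => [|i IHi] lei; first by rewrite (corner_top cr).
  by have := corner_down cr lei lej; have := IHi (ltnW lei); lia.
elim: j lej => [|j IHj] lej; first by rewrite (corner_left cr).
by have := corner_step cr lei lej; have := IHj (ltnW lej); lia.
Qed.

Lemma corner_mono_row i i' j : i <= i' -> i' <= n -> j <= n -> r i j <= r i' j.
Proof.
move=> /subnKC <-; elim: (i' - i) => [|m IHm] lei lej; first by rewrite addn0.
have lt : i + m < n by lia.
by have := corner_down cr lt lej; have := IHm (ltnW lt) lej; rewrite addnS; lia.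
Qed.

Lemma corner_mono_col i j j' : j <= j' -> i <= n -> j' <= n -> r i j <= r i j'.
Proof.
move=> /subnKC <- lei; elim: (j' - j) => [|m IHm] lej; first by rewrite addn0.
have lt : j + m < n by lia.
by have := corner_step cr lei lt; have := IHm (ltnW lt); rewrite addnS; lia.
Qed.

Lemma corner_diag i j : i < n -> j < n ->
  r i.+1 j.+1 = r i j + (if tile_at P i j == Blank then 0
                         else if tile_at P i j == Crossing then 2 else 1).
Proof.
move=> lti ltj; rewrite (tile_atE P (Ordinal lti) (Ordinal ltj)).
have := corner_down cr lti (ltnW ltj); have := corner_down cr lti ltj.
have := corner_step cr (ltnW lti) ltj; have := corner_step cr lti ltj.
by have [] := cP (Ordinal lti) (Ordinal ltj); case: (P _ _) => /=; lia.
Qed.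

Lemma corner_diag_blankless m i j : i + m <= n -> j + m <= n ->
  (forall k, k < m -> tile_at P (i + k) (j + k) != Blank) ->
  r (i + m) (j + m) =
  r i j + m + count (fun k => tile_at P (i + k) (j + k) == Crossing) (iota 0 m).
Proof.
elim: m => [|m IHm] lei lej nB; first by rewrite /= !addn0.
rewrite !addnS corner_diag; try lia.
rewrite (negbTE (nB m _)) // IHm; try lia; last by move=> k ltk; apply: nB; lia.
by rewrite -(addn1 m) iotaD count_cat /= add0n; case: (_ == Crossing) => /=; lia.
Qed.

End CornerFacts.

(** * The entries of Omega in terms of the corner function *)

Definition entry (T : filling) (a b : nat) : nat := odflt 0 (T.[? (a, b)])%fmap.

(* The second clause bounds [T] outside the grid, where the first is silent. *)
Definition encodes (n : nat) (T r : nat -> nat -> nat) : Prop :=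
  (forall a b k, a + k < n -> b + k < n -> (k < T a b) = (r (a + k.+1) (b + k.+1) <= k))
  /\ (forall a b, 0 < T a b -> a + T a b < n /\ b + T a b < n).

Lemma partition_nth la i i' : is_partition la -> i <= i' -> nth 0 la i' <= nth 0 la i.
Proof.
move=> pla le; have [lt|ge] := ltnP i' (size la); last by rewrite (nth_default _ ge).
have geq_trans : transitive geq by move=> x y z /= le1 le2; apply: leq_trans le2 le1.
have lt' : i < size la by apply: leq_ltn_trans lt.
exact: (sorted_leq_nth geq_trans leqnn 0 pla i i' lt' lt le).
Qed.

Lemma young_closed la a b a' b' : is_partition la ->
  a <= a' -> b <= b' -> young la (a', b') -> young la (a, b).
Proof. by move=> pla lea leb; rewrite /young /=; have := partition_nth pla lea; lia. Qed.

Lemma blanksP n (P : 'M[tile]_n) a b : reflect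
  [/\ a < n, b < n & tile_at P a b = Blank] ((a, b) \in blanks P).
Proof.
rewrite /blanks; apply: (iffP (imfsetP _ _ _ _)) => [[[i j] /= PB [-> ->]]|[lta ltb PB]].
  by rewrite tile_atE (eqP PB).
exists (Ordinal lta, Ordinal ltb) => //; apply/eqP.
by rewrite -[RHS]PB -tile_atE.
Qed.

Lemma index_filter_iota (p : pred nat) n x : p x -> x < n ->
  index x (filter p (iota 0 n)) = count p (iota 0 x).
Proof.
move=> px lt; have {1}-> : n = x + (n - x.+1).+1 by lia.
rewrite iotaD add0n filter_cat index_cat mem_filter mem_iota add0n ltnn !andbF /=.
by rewrite px /= eqxx addn0 size_filter.
Qed.

(** Counted from the southeast end, the position of [x] is the number of selected rows beyond it.
    Hence a blank and a crossing are paired when as many blanks precede the one as crossings follow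
    the other. *)
Lemma nth_rev_filter_iota (p : pred nat) n x : p x -> x < n ->
  nth 0 (rev (filter p (iota 0 n))) (count p (iota x.+1 (n - x.+1))) = x.
Proof.
move=> px lt; have {1}-> : n = x + (n - x.+1).+1 by lia.
rewrite iotaD add0n filter_cat /= px rev_cat rev_cons nth_cat size_rcons size_rev.
by rewrite size_filter ltnSn nth_rcons size_rev size_filter ltnn eqxx.
Qed.

(** The diagonal through (a, b) meets row [i] in column [i + b - a]; the test [a <= i + b] discards
    the rows where this subtraction is truncated. *)
Lemma diag_rowsE n (P : 'M[tile]_n) t a b :
  diag_rows P t (b%:Z - a%:Z)%R =
  [seq i <- iota 0 n | (a <= i + b) && (i + b - a < n) && (tile_at P i (i + b - a) == t)].
Proof.
rewrite /diag_rows -val_enum_ord filter_map; congr map; apply: eq_filter => i /=.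
apply/existsP/idP => [[j /andP[/eqP E /eqP Pt]]|/andP[/andP[le lt] Pt]].
  have -> : i + b - a = j by lia.
  by rewrite tile_atE Pt eqxx ltn_ord !andbT; lia.
exists (Ordinal lt); rewrite -tile_atE Pt andbT; apply/eqP => /=; lia.
Qed.

Section OmegaCorner.
Variables (n : nat) (P : 'M[tile]_n) (la : seq nat) (r : nat -> nat -> nat).
Hypotheses (HP : HBPD_of_shape la P) (cr : corner_sum n r) (cP : corner_of P r).

Lemma young_blank a b : young la (a, b) -> [/\ a < n, b < n & tile_at P a b = Blank].
Proof. by case: HP => _ _ Ela Y; apply/blanksP; rewrite Ela. Qed.

Lemma blank_young a b : a < n -> b < n -> (tile_at P a b == Blank) = young la (a, b).
Proof.
move=> lta ltb; case: HP => _ _ Ela.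
have <- : ((a, b) \in blanks P) = young la (a, b) by apply: Ela.
by apply/eqP/blanksP => [|[]].
Qed.

(** All cells northwest of (a, b) on its diagonal are blank, so [r] keeps its boundary value. *)
Lemma corner_young a b : young la (a, b) -> r a.+1 b.+1 = 0.
Proof.
case: HP => _ pla _; elim: a b => [|a IHa] b Yab; have [lta ltb PB] := young_blank Yab.
  by rewrite (corner_diag cr cP) // PB /= (corner_top cr) // ltnW.
rewrite (corner_diag cr cP) // PB /= addn0.
case: b {PB} => [|b] in Yab ltb *; first by rewrite (corner_left cr) // ltnW.
by apply: IHa; apply: young_closed Yab.
Qed.

(** The complement of a Young diagram is closed to the southeast, so no blank occurs further along
    the diagonal. *)
Lemma corner_notyoung a b k : ~~ young la (a, b) -> a + k <= n -> b + k <= n ->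
  r (a + k) (b + k) =
  r a b + k + count (fun m => tile_at P (a + m) (b + m) == Crossing) (iota 0 k).
Proof.
move=> nY lea leb; apply: (corner_diag_blankless cr cP) => // m ltm.
rewrite blank_young; try lia; case: HP => _ pla _.
by apply: contra nY; apply: young_closed => //; lia.
Qed.

(** The entry is the least t with r(a+t+1, b+t+1) > t. The diagonal step ending there is a crossing,
    and counting the blanks before (a, b) and the crossings after this one shows that the two are
    paired. *)
Lemma paired_row_young a b : young la (a, b) ->
  exists t, [/\ paired_row P (a, b) = a + t, 0 < t, a + t < n, b + t < n &
    forall k, a + k < n -> b + k < n -> (k < t) = (r (a + k.+1) (b + k.+1) <= k)].
Proof.
move=> Yab; have [lta ltb PB] := young_blank Yab; have [_ pla _] := HP.
(* (a + K, b + K) is the last cell of the diagonal; its southeast corner is on the right or bottom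
   boundary, where [r] is known and exceeds K. *)
pose K := n - (maxn a b).+1.
have exK : exists t, t < r (a + t.+1) (b + t.+1).
  exists K; have [le|lt] := leqP a b.
    have -> : b + K.+1 = n by lia.
    by rewrite (corner_right cr); lia.
  have -> : a + K.+1 = n by lia.
  by rewrite (corner_bottom cr); lia.
have [t lt_t min_t] := ex_minnP exK.
have leK : t <= K.
  apply: min_t; have [le|lt] := leqP a b.
    have -> : b + K.+1 = n by lia.
    by rewrite (corner_right cr); lia.
  have -> : a + K.+1 = n by lia.
  by rewrite (corner_bottom cr); lia.
have t_gt0 : 0 < t.
  by case: t lt_t {min_t leK} => //; rewrite !addn1 corner_young.
have le_t : r (a + t) (b + t) <= t.-1.
  case: t t_gt0 min_t {lt_t leK} => //= t _ min_t; rewrite leqNgt.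
  by apply/negP => /min_t; rewrite ltnn.
have lat : a + t < n by lia.
have lbt : b + t < n by lia.
have dgE := corner_diag cr cP lat lbt; rewrite -!addnS in dgE.
(* Here [r] rises from at most t - 1 to more than t, that is, by two. *)
have PC : tile_at P (a + t) (b + t) = Crossing.
  apply/eqP/negPn/negP => /negbTE nC; move: dgE; rewrite nC; case: (_ == _); lia.
rewrite PC /= in dgE.
have nY : ~~ young la (a + t.+1, b + t.+1).
  apply/negP => Y; suff : r (a + t.+1) (b + t.+1) <= 0 by lia.
  by rewrite -(corner_young Y) (leq_trans (corner_mono_row cr (leqnSn _) _ _)) //;
    have [] := young_blank Y; [| |move=> *; apply: (corner_mono_col cr)]; lia.
exists t; split=> //.
  rewrite /paired_row /= !diag_rowsE index_filter_iota ?addKn ?PB ?eqxx ?andbT ?ltb //;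
    try lia.
  (* Every earlier cell of the diagonal is blank, and there are min(a, b) of them. *)
  have -> : count (fun i => (a <= i + b) && (i + b - a < n) &&
                     (tile_at P i (i + b - a) == Blank)) (iota 0 a) = minn a b.
    rewrite (eq_in_count (a2 := fun i => a <= i + b)); last first.
      move=> i; rewrite mem_iota /= add0n => lti; case: (leqP a (i + b)) => //= le.
      have -> /= : i + b - a < n by lia.
      by rewrite blank_young; try lia; apply: (young_closed pla _ _ Yab); lia.
    have [le|lt] := leqP a b.
      by rewrite (eq_in_count (a2 := predT)) ?count_predT ?size_iota // => i _ /=; lia.
    rewrite -[in iota 0 a](subnK (ltnW lt)) iotaD count_cat.
    rewrite (eq_in_count (a2 := pred0)) ?count_pred0; last first.
      by move=> i; rewrite mem_iota /=; lia.
    rewrite (eq_in_count (a2 := predT)) ?count_predT ?size_iota //.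
    by move=> i; rewrite mem_iota /=; lia.
  set pC := (fun i => _ && (_ == Crossing)).
  (* After the crossing [r] equals t + 1 and no blank follows. The known boundary value then exceeds
     t + 1 plus the number of remaining steps by the number of remaining crossings. *)
  have <- : count pC (iota (a + t).+1 (n - (a + t).+1)) = minn a b.
    have -> : n - (a + t).+1 = (K - t) + ((maxn a b) - a) by lia.
    rewrite iotaD count_cat [X in _ + X](eq_in_count (a2 := pred0)) ?count_pred0;
      last first.
      move=> i; rewrite mem_iota /= /pC => /andP[le_i lt_i].
      by case: (_ == Crossing); lia.
    have lea : a + t.+1 + (K - t) <= n by lia.
    have leb : b + t.+1 + (K - t) <= n by lia.
    have := corner_notyoung nY lea leb.
    rewrite addn0 -(addn0 (a + t).+1) iotaDl count_map.
    rewrite [X in _ -> X = _](eq_in_count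
      (a2 := (fun m => tile_at P (a + t.+1 + m) (b + t.+1 + m) == Crossing)));
      last first.
      move=> i; rewrite mem_iota /= => ?; rewrite /pC.
      have -> : (a + t).+1 + i + b - a = b + t.+1 + i by lia.
      by rewrite !(addnS, addSn); case: (_ == Crossing); lia.
    set c := count _ _; have [le|lt] := leqP a b.
      have -> : b + t.+1 + (K - t) = n by lia.
      by rewrite (corner_right cr); lia.
    have -> : a + t.+1 + (K - t) = n by lia.
    by rewrite (corner_bottom cr); lia.
  rewrite nth_rev_filter_iota // /pC.
  have -> : a + t + b - a = b + t by lia.
  by rewrite PC eqxx; lia.
move=> k ltak ltbk; apply/idP/idP => [ltk|].
  by rewrite leqNgt; apply/negP => /min_t; lia.
apply: contraTT; rewrite -leqNgt -ltnNge => le.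
(* From the value t + 1 on, [r] grows by at least one per diagonal step, so it stays above k. *)
have := corner_notyoung (k := k - t) nY.
have -> : a + t.+1 + (k - t) = a + k.+1 by lia.
have -> : b + t.+1 + (k - t) = b + k.+1 by lia.
by move=> ->; lia.
Qed.

Lemma domf_Omega : domf (Omega P) = blanks P.
Proof. by []. Qed.

Lemma entry_notyoung a b : ~~ young la (a, b) -> entry (Omega P) a b = 0.
Proof.
move=> nY; rewrite /entry not_fnd //.
have nB : (a, b) \notin blanks P by case: HP => _ _ ->.
exact: nB.
Qed.

Lemma Omega_young a b : young la (a, b) ->
  (Omega P).[? (a, b)]%fmap = Some (paired_row P (a, b) - a).
Proof.
move=> Y; have [_ _ Ela] := HP.
have B : (a, b) \in blanks P by rewrite Ela.
by rewrite in_fnd ffunE.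
Qed.

Lemma entry_gt0 a b : (0 < entry (Omega P) a b) = young la (a, b).
Proof.
have [Y|nY] := boolP (young la (a, b)); last by rewrite entry_notyoung.
by rewrite /entry Omega_young //=; have [t [-> ? _ _ _]] := paired_row_young Y; lia.
Qed.

Lemma Omega_encodes : encodes n (entry (Omega P)) r.
Proof.
split=> a b; last first.
  rewrite entry_gt0 => Y; rewrite /entry Omega_young //=.
  by have [t [-> ? ? ? _]] := paired_row_young Y; rewrite addKn.
move=> k lea leb; have [Y|nY] := boolP (young la (a, b)).
  rewrite /entry Omega_young //=.
  by have [t [-> _ _ _]] := paired_row_young Y; rewrite addKn; apply.
by rewrite entry_notyoung // (corner_notyoung nY); lia.
Qed.

End OmegaCorner.

(** * The corner function of a decreasing tableau *)

(** For a filling extended by 0 this includes that the support is closed to the northwest. *)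
Definition decreasing (T : nat -> nat -> nat) : Prop :=
  forall a b, (0 < T a b.+1 -> T a b.+1 < T a b) /\ (0 < T a.+1 b -> T a.+1 b < T a b).

Lemma decreasing_se T a b a' b' : decreasing T -> a <= a' -> b <= b' ->
  0 < T a' b' -> T a' b' + (a' - a) + (b' - b) <= T a b.
Proof.
move=> dT /subnKC <- /subnKC <-; rewrite !addKn.
elim: (a' - a) => [|m IHm]; last first.
  rewrite addnS => T0; have [_ /(_ T0) lt] := dT (a + m) (b + (b' - b)).
  by have := IHm (leq_ltn_trans (leq0n _) lt); lia.
rewrite addn0; elim: (b' - b) => [|m IHm] T0; first by rewrite !addn0.
rewrite addnS in T0 *; have [/(_ T0) lt _] := dT a (b + m).
by have := IHm (leq_ltn_trans (leq0n _) lt); lia.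
Qed.

Section Encodes.
Variables (n : nat) (T r : nat -> nat -> nat).
Hypotheses (cr : corner_sum n r) (eT : encodes n T r).

(** If t is the entry at the right or lower neighbour, then [r] is at most t - 1 at the grid vertex
    that tests t - 1 there. One unit step down or right from it reaches the vertex that tests t at
    (a, b), where [r] is thus at most t. *)
Lemma encodes_decreasing : decreasing T.
Proof.
have [eT1 eT2] := eT => a b; split=> T0; have [lea leb] := eT2 _ _ T0;
  set t := T _ _ in T0 lea leb *.
- have ra : r (a + t) (b.+1 + t) <= t.-1.
    by have E := eT1 a b.+1 t.-1; rewrite prednK // in E; rewrite -E; lia.
  rewrite eT1; try lia; rewrite addnS -[b + _]addSnnS.
  by have := corner_down cr lea (ltnW leb); lia.
- have ra : r (a.+1 + t) (b + t) <= t.-1.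
    by have E := eT1 a.+1 b t.-1; rewrite prednK // in E; rewrite -E; lia.
  rewrite eT1; try lia; rewrite -[a + _]addSnnS addnS.
  by have := corner_step cr (ltnW lea) leb; lia.
Qed.

(** Solves the encoding for [r]: all upper bounds on [r i j], hence [r i j] itself, are read off
    from [T]. *)
Lemma encodes_corner i j k : i <= n -> j <= n ->
  (r i j <= k) = (minn i j <= k) || (k < T (i - k.+1) (j - k.+1)).
Proof.
move=> lei lej; have [le|lt] /= := leqP (minn i j) k.
  by rewrite (leq_trans (corner_le cr lei lej) le).
have [eT1 _] := eT; rewrite eT1; try lia.
by rewrite !subnK; lia.
Qed.

End Encodes.

Lemma encodes_corner_inj n T r r' : corner_sum n r -> corner_sum n r' ->
  encodes n T r -> encodes n T r' -> forall i j, i <= n -> j <= n -> r i j = r' i j.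
Proof.
move=> cr cr' eT eT' i j lei lej; apply/eqP; rewrite eqn_leq.
by rewrite (encodes_corner cr eT) // -(encodes_corner cr' eT') // leqnn
  (encodes_corner cr' eT') // -(encodes_corner cr eT) // leqnn.
Qed.

Lemma encodes_inj n T T' r : encodes n T r -> encodes n T' r ->
  forall a b, T a b = T' a b.
Proof.
have le U V a b : encodes n U r -> encodes n V r -> U a b <= V a b.
  move=> [U1 U2] [V1 _]; case E: (U a b) => [//|t].
  have [] := U2 a b; rewrite E // => lea leb.
  have lta : a + t < n by lia.
  have ltb : b + t < n by lia.
  by rewrite V1 // -U1 // E.
by move=> eT eT' a b; apply/eqP; rewrite eqn_leq !le.
Qed.

Section TableauCorner.
Variables (n : nat) (T : nat -> nat -> nat).
Hypotheses (dT : decreasing T) (leT : forall a b, T a b <= n.-1).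

(* The least k with k < T(i-1-k, j-1-k), where T is infinite outside the
   quadrant. *)
Definition tableau_corner (i j : nat) : nat :=
  find (fun k => k < T (i - k.+1) (j - k.+1)) (iota 0 (minn i j)).

Lemma tableau_cornerP i j : let k := tableau_corner i j in
  [/\ k <= minn i j, k < minn i j -> k < T (i - k.+1) (j - k.+1)
    & forall m, m < k -> T (i - m.+1) (j - m.+1) <= m].
Proof.
rewrite /tableau_corner; set p := fun k => _.
have le := find_size p (iota 0 (minn i j)); rewrite size_iota in le.
split=> // [lt|m ltm].
  have := nth_find 0 (s := iota 0 (minn i j)) (a := p).
  rewrite has_find size_iota lt nth_iota //.
  by apply.
have := before_find 0 ltm; rewrite nth_iota ?add0n; last by lia.
by rewrite /p ltnNge => /negbFE.
Qed.

(** The condition is monotone in k: raising k by one moves the tested cell one step northwest, which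
    raises a positive entry by at least two. *)
Lemma tableau_corner_le i j k :
  (tableau_corner i j <= k) = (minn i j <= k) || (k < T (i - k.+1) (j - k.+1)).
Proof.
have [le ltT geT] := tableau_cornerP i j; set c := tableau_corner i j in le ltT geT *.
have [lek|ltk] /= := leqP (minn i j) k; first by apply: leq_trans lek.
apply/idP/idP => [lek|]; last first.
  by apply: contraTT; rewrite -ltnNge -leqNgt; apply: geT.
have := @decreasing_se T (i - k.+1) (j - k.+1) (i - c.+1) (j - c.+1) dT.
by have := ltT (leq_ltn_trans lek ltk); lia.
Qed.

(** Climbing to row 0 raises a positive entry by at least [a], and the entry there is at most n -
    1. *)
Lemma row_entry_lt a b : 0 < n -> a + T a b < n \/ T a b = 0.
Proof.
move=> n0; case E: (T a b) => [|t]; [by right | left].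
have := @decreasing_se T 0 b a b dT; rewrite E; have := leT 0 b; lia.
Qed.

Lemma col_entry_lt a b : 0 < n -> b + T a b < n \/ T a b = 0.
Proof.
move=> n0; case E: (T a b) => [|t]; [by right | left].
have := @decreasing_se T a 0 a b dT; rewrite E; have := leT a 0; lia.
Qed.

Lemma tableau_corner_sum : 0 < n -> corner_sum n tableau_corner.
Proof.
move=> n0.
have min_le i j : tableau_corner i j <= minn i j by rewrite tableau_corner_le leqnn.
split=> [i _|j _|i lei|j lej|i j lti lej|i j lei ltj].
- by have := min_le i 0; lia.
- by have := min_le 0 j; lia.
- apply/eqP; rewrite eqn_leq; apply/andP; split; first by have := min_le i n; lia.
  (* A value c < i would put an entry larger than c in column n - c - 1, against [col_entry_lt]. *)
  rewrite leqNgt; apply/negP; have [le ltT _] := tableau_cornerP i n => lt.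
  set c := tableau_corner i n in le ltT lt; have := ltT.
  by have := col_entry_lt (i - c.+1) (n - c.+1) n0; lia.
- apply/eqP; rewrite eqn_leq; apply/andP; split; first by have := min_le n j; lia.
  rewrite leqNgt; apply/negP; have [le ltT _] := tableau_cornerP n j => lt.
  set c := tableau_corner n j in le ltT lt; have := ltT.
  by have := row_entry_lt (n - c.+1) (j - c.+1) n0; lia.
- apply/andP; split.
    rewrite tableau_corner_le; set c := tableau_corner _ _.
    have := tableau_corner_le i.+1 j c; rewrite leqnn => /esym/orP[?|lt]; first by lia.
    have [//|/= ltc] := leqP (minn i j) c.
    have -> := leq_trans lt _ => //.
    (* For the same c, the cell tested at (i, j) is one row above the cell tested at (i + 1, j). *)
    have := @decreasing_se T (i - c.+1) (j - c.+1) (i.+1 - c.+1) (j - c.+1) dT; lia.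
  rewrite tableau_corner_le; set c := tableau_corner _ _.
  have := tableau_corner_le i j c; rewrite leqnn => /esym/orP[?|lt]; first by lia.
  have [//|/= ltc] := leqP (minn i.+1 j) c.+1.
  (* Passing to c + 1 while adding a row moves the tested cell one column left, where the entry is
     at least one larger. *)
  have := @decreasing_se T (i.+1 - c.+2) (j - c.+2) (i - c.+1) (j - c.+1) dT; lia.
- apply/andP; split.
    rewrite tableau_corner_le; set c := tableau_corner _ _.
    have := tableau_corner_le i j.+1 c; rewrite leqnn => /esym/orP[?|lt]; first by lia.
    have [//|/= ltc] := leqP (minn i j) c.
    have -> := leq_trans lt _ => //.
    have := @decreasing_se T (i - c.+1) (j - c.+1) (i - c.+1) (j.+1 - c.+1) dT; lia.
  rewrite tableau_corner_le; set c := tableau_corner _ _.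
  have := tableau_corner_le i j c; rewrite leqnn => /esym/orP[?|lt]; first by lia.
  have [//|/= ltc] := leqP (minn i j.+1) c.+1.
  have := @decreasing_se T (i - c.+2) (j.+1 - c.+2) (i - c.+1) (j - c.+1) dT; lia.
Qed.

Lemma tableau_corner_encodes : 0 < n -> encodes n T tableau_corner.
Proof.
move=> n0; split=> [a b k lea leb|a b T0]; last first.
  by have := row_entry_lt a b n0; have := col_entry_lt a b n0; lia.
rewrite tableau_corner_le !addnK; case: leqP => //; lia.
Qed.

(** A positive entry makes both values 0. Conversely, a common value c gives T(a-c, b-c) > c by its
    definition at (a+1, b+1), whereas for c > 0 its minimality at (a, b) gives T(a-c, b-c) < c; so c
    = 0. *)
Lemma tableau_corner_blank a b :
  (tableau_corner a.+1 b.+1 == tableau_corner a b) = (0 < T a b).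
Proof.
apply/eqP/idP => [|T0]; last first.
  have -> : tableau_corner a.+1 b.+1 = 0.
    by apply/eqP; rewrite -leqn0 tableau_corner_le !subn1 T0 orbT.
  apply/eqP; rewrite eq_sym -leqn0 tableau_corner_le.
  case: a T0 => [|a] T0; first by rewrite min0n.
  case: b T0 => [|b] T0; first by rewrite minn0.
  rewrite !subn1 /=.
  by have := @decreasing_se T a b a.+1 b.+1 dT; lia.
have [le ltT geT] := tableau_cornerP a b.
have [le' ltT' geT'] := tableau_cornerP a.+1 b.+1.
move=> E; rewrite E in le' ltT' geT'.
set c := tableau_corner a b in E le ltT geT le' ltT' geT'.
have := ltT'; rewrite !subSS.
case: c {E ltT'} le ltT geT le' geT' => [|c] le ltT geT le' geT'.
  by rewrite !subn0; apply; lia.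
by have := geT c (ltnSn _); lia.
Qed.

End TableauCorner.

(** * Tableaux as functions extended by 0, and bijectivity of [Omega] *)

Lemma decreasing_tableau la (T : filling) : is_partition la ->
  domf T =i young la -> (forall a b, young la (a, b) -> 0 < entry T a b) ->
  decreasing (entry T) -> dec_tableau_of_shape la T.
Proof.
move=> pla Ela T0 dT.
have entryE a b x : (T.[? (a, b)])%fmap = Some x -> entry T a b = x /\ 0 < x.
  move=> E; have Y : (a, b) \in domf T by rewrite -fndSome E.
  rewrite Ela in Y; have := T0 a b Y.
  by rewrite /entry E.
split=> // [[a b] x /entryE[]//|i j j' x x' ltj|i i' j x x' lti]
  /entryE[Ex _] /entryE[Ex' x'0].
- by have := @decreasing_se _ i j i j' dT; rewrite Ex Ex'; lia.
- by have := @decreasing_se _ i j i' j dT; rewrite Ex Ex'; lia.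
Qed.

Lemma tableau_decreasing la (T : filling) : dec_tableau_of_shape la T ->
  decreasing (entry T) /\ (forall a b, (0 < entry T a b) = young la (a, b)).
Proof.
case=> pla Ela T0 Trow Tcol.
have entryE a b : (0 < entry T a b) = young la (a, b).
  have <- : ((a, b) \in domf T) = young la (a, b) by apply: Ela.
  rewrite /entry; case: fndP => // ab /=; apply: (T0 (a, b)); exact: in_fnd.
have fnd a b : 0 < entry T a b -> (T.[? (a, b)])%fmap = Some (entry T a b).
  by rewrite /entry; case: (T.[? _])%fmap.
split=> // a b; split=> E.
- have E' : 0 < entry T a b.
    by move: E; rewrite !entryE; apply: young_closed.
  exact: Trow (ltnSn b) (fnd _ _ E') (fnd _ _ E).
- have E' : 0 < entry T a b.
    by move: E; rewrite !entryE; apply: young_closed.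
  exact: Tcol (ltnSn a) (fnd _ _ E') (fnd _ _ E).
Qed.

(** [entry] confuses an absent cell with the value 0; positivity on the domains excludes this. *)
Lemma entry_inj (T U : filling) : (forall a b, entry T a b = entry U a b) ->
  (forall a b, (a, b) \in domf T -> 0 < entry T a b) ->
  (forall a b, (a, b) \in domf U -> 0 < entry U a b) -> T = U.
Proof.
move=> E T0 U0; apply/fmapP => -[a b].
have := E a b; have := T0 a b; have := U0 a b; rewrite /entry -!fndSome.
case: (T.[? _])%fmap => [x|]; case: (U.[? _])%fmap => [y|] //=.
- by move=> _ _ ->.
- by move=> _ /(_ isT) + E'; rewrite E'.
- by move=> /(_ isT) + _ E'; rewrite -E'.
Qed.

Lemma Omega_tableau n la (P : 'M[tile]_n) :
  HBPD_of_shape la P -> dec_tableau_of_shape la (Omega P).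
Proof.
move=> HP; have [bP pla Ela] := HP.
have cr := corner_sumP bP; have cP := corner_ofP bP.
apply: decreasing_tableau => // [a b Y|].
  by rewrite (entry_gt0 HP cr cP).
exact: encodes_decreasing (Omega_encodes HP cr cP).
Qed.

Lemma Omega_DT n (P : 'M[tile]_n) : HBPD P -> DT n.-1 (Omega P).
Proof.
move=> [la HP]; split; first by exists la; apply: Omega_tableau.
have [bP _ _] := HP; have [_ eT] := Omega_encodes HP (corner_sumP bP) (corner_ofP bP).
move=> [a b] x E; case: x E => // x E; have := eT a b.
rewrite /entry E => /(_ isT) /=; lia.
Qed.

Lemma corner_of_ext n (P : 'M[tile]_n) r r' :
  (forall i j, i <= n -> j <= n -> r i j = r' i j) -> corner_of P r -> corner_of P r'.
Proof.
move=> E cP i j; have [-> -> -> ->] := cP i j.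
by rewrite !E // ltnW.
Qed.

Lemma Omega_inj n (P Q : 'M[tile]_n) : HBPD P -> HBPD Q -> Omega P = Omega Q -> P = Q.
Proof.
move=> [la HP] [la' HQ] E; have [bP _ _] := HP; have [bQ _ _] := HQ.
have eP := Omega_encodes HP (corner_sumP bP) (corner_ofP bP).
have eQ := Omega_encodes HQ (corner_sumP bQ) (corner_ofP bQ); rewrite -E in eQ.
apply: (@corner_of_inj _ _ _ (corner Q)) (corner_ofP bQ).
apply: corner_of_ext (corner_ofP bP).
exact: encodes_corner_inj (corner_sumP bP) (corner_sumP bQ) eP eQ.
Qed.

(** The preimage is the BPD of [tableau_corner]: its blanks are the diagonal steps where [r] is
    constant, which are the cells of the tableau. *)
Lemma Omega_surj n (T : filling) : 0 < n -> DT n.-1 T ->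
  exists P : 'M[tile]_n, HBPD P /\ Omega P = T.
Proof.
move=> n0 [[la tT] leT]; have [dT T0] := tableau_decreasing tT.
have leT' a b : entry T a b <= n.-1.
  by rewrite /entry; case E: (T.[? _])%fmap => [x|] //=; apply: leT E.
have cr := tableau_corner_sum dT leT' n0; have eT := tableau_corner_encodes dT leT' n0.
set r := tableau_corner _ in cr eT.
pose P := (\matrix_(i < n, j < n) tile_of r i j)%R.
have cP : corner_of P r by apply: corner_of_tile_of.
have HP : HBPD_of_shape la P.
  split; [exact: is_bpd_corner cr cP | by case: tT | move=> [a b]].
  have -> : ((a, b) \in young la) = (0 < entry T a b) by rewrite T0.
  rewrite -(tableau_corner_blank dT) -/r.
  apply/blanksP/eqP => [[lta ltb PB]|E].
    by rewrite (corner_diag cr cP) // PB addn0.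
  have ltab : 0 < entry T a b by rewrite -(tableau_corner_blank dT) -/r E.
  have [_ /(_ a b ltab)[lta ltb]] := eT.
  split; try lia; apply/eqP/negPn/negP => nB.
  have := corner_diag cr cP (i := a) (j := b); rewrite (negbTE nB) E.
  by case: (_ == Crossing); lia.
exists P; split; first by exists la.
(* [T] and [Omega P] are now encoded by the same [r]. *)
have eP := Omega_encodes HP cr cP.
apply: entry_inj => a b.
- exact: encodes_inj eP eT a b.
- by rewrite (entry_gt0 HP cr cP); case: HP => _ _ Ela; rewrite domf_Omega Ela.
- by rewrite T0; case: tT => _ Ela _ _ _; rewrite Ela.
Qed.

(** * Demazure operators *)

Definition hecke_step (n : nat) (w : 'S_n) (a : nat) : 'S_n :=
  if perm_length w < perm_length (mul_simple w a) then mul_simple w a else w.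

Lemma demazure_mul_simple_basis n (w : 'S_n) a :
  demazure_mul_simple (demazure_basis w) a = demazure_basis (hecke_step w a).
Proof.
rewrite /demazure_mul_simple (bigD1 w) //= big1 ?GRing.addr0 => [|u /negbTE uw].
  by rewrite ffunE eqxx mulr1z.
by rewrite ffunE uw mulr0z.
Qed.

Lemma demazure_wordE n a :
  demazure_word n a = demazure_basis (foldl (@hecke_step n) 1%g a).
Proof.
rewrite /demazure_word; elim: a 1%g => //= x a IHa w.
by rewrite demazure_mul_simple_basis IHa.
Qed.

(** The transposition keeps the order of every pair a < b other than (i, j). It thus maps the
    inversions of [w] injectively to inversions of the product, and the new inversion (i, j) is not
    in the image. *)
Lemma perm_length_tperm n (w : 'S_n) (i j : 'I_n) : j = i.+1 :> nat -> w i < w j ->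
  perm_length w < perm_length (tperm i j * w)%g.
Proof.
move=> ji lt_w; set s := tperm i j.
have lt_s (a b : 'I_n) : a < b -> (a, b) != (i, j) -> s a < s b.
  rewrite xpair_eqE -!val_eqE /= => lt_ab ne.
  have neqV (x y : 'I_n) : x <> y -> x <> y :> nat by move=> xy /val_inj.
  have eqV (x y : 'I_n) : x = y -> x = y :> nat by move=> ->.
  rewrite /s; case: tpermP => [/eqV ?|/eqV ?|/neqV ? /neqV ?];
    case: tpermP => [/eqV ?|/eqV ?|/neqV ? /neqV ?]; lia.
pose f (p : 'I_n * 'I_n) := (s p.1, s p.2).
have inj_f : injective f by move=> [a b] [c d] [] /perm_inj -> /perm_inj ->.
rewrite /perm_length -(card_imset _ inj_f); apply/proper_card/properP; split.
  apply/subsetP => _ /imsetP[[a b] + ->]; rewrite !inE /= !permM !tpermK.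
  move=> /andP[lt_ab lt_ba]; rewrite lt_ba andbT lt_s //.
  by apply: contraTneq lt_ba => -[-> ->]; rewrite -leqNgt ltnW.
exists (i, j).
  by rewrite inE /= !permM tpermL tpermR ji ltnSn.
apply/negP => /imsetP[[a b]]; rewrite inE /= => /andP[lt_ab _] [Ea Eb].
have Ea' : a = j by apply: (@perm_inj _ s); rewrite -Ea tpermR.
have Eb' : b = i by apply: (@perm_inj _ s); rewrite -Eb tpermL.
by move: lt_ab; rewrite Ea' Eb' ji; lia.
Qed.

Lemma hecke_stepE n (w : 'S_n) (i j : 'I_n) : j = i.+1 :> nat ->
  hecke_step w j = if w i < w j then (tperm i j * w)%g else w.
Proof.
move=> ji; have Ei : insub (val j).-1 = Some i by rewrite /= ji valK.
rewrite /hecke_step /mul_simple /simple_transp Ei valK /=.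
have [lt|le] := ltnP (w i) (w j); first by rewrite perm_length_tperm.
have ne : (i : nat) != j by lia.
have lt : w j < w i.
  by rewrite ltn_neqAle le andbT; apply: contra ne => /eqP/val_inj/perm_inj ->.
(* A descent of [w] is an ascent of [tperm i j * w], to which the length lemma applies. *)
rewrite ltnNge ltnW //= -{2}(mulKg (tperm i j) w) tpermV.
by apply: perm_length_tperm; rewrite ?permM ?tpermL ?tpermR.
Qed.

Lemma ord_letter n a : 0 < a < n ->
  exists i j : 'I_n, [/\ j = i.+1 :> nat, i = a.-1 :> nat & a = j].
Proof.
move=> /andP[a0 lta]; have lti : a.-1 < n by lia.
by exists (Ordinal lti), (Ordinal lta); split => //=; lia.
Qed.

(** The two transpositions are disjoint, so neither moves a value that the other compares. *)
Lemma hecke_stepC n (w : 'S_n) a b : 0 < a < n -> 0 < b < n ->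
  (a.+1 < b) || (b.+1 < a) ->
  hecke_step (hecke_step w a) b = hecke_step (hecke_step w b) a.
Proof.
move=> /ord_letter[i [j [ji _ ->]]] /ord_letter[k [l [lk _ ->]]] far.
have [ik jk il jl] : [/\ i != k, j != k, i != l & j != l].
  by rewrite -!val_eqE /=; split; lia.
rewrite !(hecke_stepE _ ji) !(hecke_stepE _ lk).
have C : (tperm i j * tperm k l = tperm k l * tperm i j)%g.
  by rewrite conjgC tpermJ !tpermD // eq_sym.
have Ek : (tperm i j * w)%g k = w k by rewrite permM tpermD.
have El : (tperm i j * w)%g l = w l by rewrite permM tpermD.
have Ei : (tperm k l * w)%g i = w i by rewrite permM tpermD // eq_sym.
have Ej : (tperm k l * w)%g j = w j by rewrite permM tpermD // eq_sym.
case ij: (w i < w j); case kl: (w k < w l); rewrite ?Ek ?El ?Ei ?Ej ?ij ?kl //.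
by rewrite !mulgA C.
Qed.

Definition perm_at (n : nat) (w : 'S_n) (k : nat) : option 'I_n := omap w (insub k).

Lemma perm_atE n (w : 'S_n) (i : 'I_n) : perm_at w i = Some (w i).
Proof. by rewrite /perm_at valK. Qed.

Lemma perm_at_step n (w : 'S_n) a k : 0 < a < n -> k != a.-1 -> k != a ->
  perm_at (hecke_step w a) k = perm_at w k.
Proof.
move=> /ord_letter[i [j [ji _ ->]]]; rewrite (hecke_stepE _ ji) {1}ji /= => ki kj.
case: ifP => // _.
have [ltk|lek] := ltnP k n; last by rewrite /perm_at insubF ?ltnNge ?lek.
rewrite !(perm_atE _ (Ordinal ltk)) permM tpermD //;
  by rewrite -val_eqE eq_sym.
Qed.

(** Pushed across a crossing, the cut replaces its left and bottom edges by the top and right ones.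
    The Demazure step puts the larger label first, that is, on the top edge. *)
Lemma tile_out_Crossing n (w : 'S_n) a : a.+1 < n ->
  tile_out Crossing (perm_at w a) (perm_at w a.+1) =
  (perm_at (hecke_step w a.+1) a.+1, perm_at (hecke_step w a.+1) a).
Proof.
move=> lta; have /ord_letter[i [j [ji Ei Ej]]] : 0 < a.+1 < n by [].
rewrite /= in Ei; rewrite Ej -Ei (hecke_stepE _ ji) !perm_atE /=.
by case: ltnP => _; rewrite ?permM ?tpermL ?tpermR.
Qed.

(** The head [x] of [s1] can be moved to the front of [s2]: each element it passes comes after [x]
    in [s1] but before [x] in [s2], hence commutes with it. Then induct. *)
Lemma foldl_reorder (A : eqType) (S : Type) (op : S -> A -> S) (e1 e2 : rel A)
    (s1 s2 : seq A) z :
  perm_eq s1 s2 -> uniq s1 -> pairwise e1 s1 -> pairwise e2 s2 ->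
  (forall x y, x \in s1 -> y \in s1 -> x != y -> e1 x y -> e2 y x ->
     forall u, op (op u x) y = op (op u y) x) ->
  foldl op z s1 = foldl op z s2.
Proof.
elim: s1 s2 z => [|x s1 IHs] s2 z.
  by move=> /perm_size/esym/size0nil ->.
move=> ps /= /andP[xs1 us1] /andP[/allP e1x pw1] pw2 C.
have : x \in s2 by rewrite -(perm_mem ps) mem_head.
move=> /path.splitPr E2; case: E2 ps pw2 => u v ps.
rewrite pairwise_cat /= => /and3P[/allrelP e2u pwu /andP[_ pwv]].
have ps' : perm_eq s1 (u ++ v).
  by rewrite -(perm_cons x) (perm_trans ps) // perm_catC /= perm_cons perm_catC.
have us1' y : y \in u -> y \in s1 by rewrite (perm_mem ps') mem_cat => ->.
have -> : foldl op z (u ++ x :: v) = foldl op (op z x) (u ++ v).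
  rewrite !foldl_cat /=; congr foldl.
  have Cu y t : y \in u -> op (op t x) y = op (op t y) x.
    move=> yu; apply: C; rewrite ?mem_head // ?inE ?us1' ?orbT //.
    - by apply: contraNneq xs1 => ->; apply: us1'.
    - by apply/e1x/us1'.
    - by apply: e2u; rewrite ?mem_head.
  elim: u z Cu {ps e2u pwu ps' us1'} => //= y u IHu z Cu.
  rewrite Cu ?mem_head // IHu // => t' t ?.
  by apply: Cu; rewrite inE orbC; apply/orP; left.
apply: IHs => //.
  rewrite pairwise_cat pwu pwv !andbT; apply/allrelP => a b ? ?.
  by apply: e2u; rewrite // inE orbC; apply/orP; left.
by move=> a b ? ?; apply: C; rewrite inE orbC; apply/orP; left.
Qed.

(** * Label propagation *)

Lemma rev_iotaS m : rev (iota 0 m.+1) = m :: rev (iota 0 m).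
Proof. by rewrite -addn1 iotaD cats1 rev_rcons. Qed.

Lemma foldl_enum_ord (S : Type) n (F : S -> 'I_n -> S) (g : nat -> S) :
  (forall j : 'I_n, F (g j) j = g j.+1) -> foldl F (g 0) (enum 'I_n) = g n.
Proof.
move=> Fg; suff E m : m <= n -> foldl F (g 0) (take m (enum 'I_n)) = g m.
  by have := E n (leqnn n); rewrite take_oversize // size_enum_ord.
elim: m => [|m IHm] lem; first by rewrite take0.
rewrite (take_nth (Ordinal lem)) ?size_enum_ord // foldl_rcons IHm 1?ltnW //.
by rewrite (nth_ord_enum (Ordinal lem) (Ordinal lem)); apply: (Fg (Ordinal lem)).
Qed.

Section Labels.
Variables (n : nat) (P : 'M[tile]_n) (r : nat -> nat -> nat).
Hypotheses (cr : corner_sum n r) (cP : corner_of P r).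

(* [v] lists the labels along a cut from the top boundary to the bottom right
   corner; an edge is the [r]-th edge of the cut met by a pipe, where [r] is taken
   at its top or left end. *)
Definition row_label (v : 'S_n) (i j : nat) : edge_label n :=
  if r i j < r i.+1 j then perm_at v (r i j) else None.

Definition col_label (v : 'S_n) (i j : nat) : edge_label n :=
  if r i j < r i j.+1 then perm_at v (r i j) else None.

Definition cross_step (v : 'S_n) (c : nat * nat) : 'S_n :=
  hecke_step v (r c.1 c.2).+1.

Definition crossings_in_col (j m : nat) : seq (nat * nat) :=
  [seq (i, j) | i <- rev (iota 0 m) & tile_at P i j == Crossing].

Fixpoint crossings (j : nat) : seq (nat * nat) :=
  if j is j'.+1 then crossings j' ++ crossings_in_col j' n else [::].

Lemma crossingP i j : tile_at P i j = Crossing ->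
  [/\ i < n, j < n & r i.+1 j.+1 = (r i j).+2].
Proof.
move=> C; have [lti ltj] : i < n /\ j < n.
  move: C; rewrite /tile_at; case: insubP => [? ? <-|] //=.
  by case: insubP => [? ? <-|//] _; rewrite !ltn_ord.
by split=> //; rewrite (corner_diag cr cP) // C addn2.
Qed.

Lemma mem_crossings_in_col j m c :
  (c \in crossings_in_col j m) =
  [&& c.1 < m, c.2 == j & tile_at P c.1 c.2 == Crossing].
Proof.
apply/mapP/and3P => [[i]|[lt /eqP <- C]].
  by rewrite mem_filter mem_rev mem_iota => /andP[C /andP[_ lt]] ->; split.
by exists c.1; rewrite ?mem_filter ?mem_rev ?mem_iota ?C //; case: c {lt C}.
Qed.

Lemma mem_crossings j c : (c \in crossings j) =
  (c.2 < j) && (tile_at P c.1 c.2 == Crossing).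
Proof.
elim: j => //= j IHj; rewrite mem_cat IHj mem_crossings_in_col ltnS [in RHS]leq_eqVlt.
case: (altP (tile_at P c.1 c.2 =P Crossing)) => [/crossingP[-> _ _]|];
  last by rewrite !andbF.
by rewrite !andbT orbC.
Qed.

(** A crossing [c] affects only the positions [r c.1 c.2] and [r c.1 c.2 + 1], all below [k]
    here. *)
Lemma perm_at_foldl v s k :
  (forall c, c \in s -> r c.1 c.2 + 1 < n /\ r c.1 c.2 + 1 < k) ->
  perm_at (foldl cross_step v s) k = perm_at v k.
Proof.
elim: s v => //= c s IHs v H.
rewrite IHs => [|c' c's]; last by apply: H; rewrite inE c's orbT.
by have [lt1 lt2] := H c (mem_head _ _); rewrite perm_at_step //; lia.
Qed.

(** Pushing the cut across one cell: except at a crossing, the pipes keep their positions along the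
    cut. *)
Lemma tile_out_labels v i j : i < n -> j < n ->
  let v1 := if tile_at P i j == Crossing then cross_step v (i, j) else v in
  tile_out (tile_at P i j) (row_label v i j) (col_label v i.+1 j) =
  (row_label v1 i j.+1, col_label v1 i j).
Proof.
move=> lti ltj /=.
have := cP (Ordinal lti) (Ordinal ltj); rewrite -tile_atE /=.
have := corner_down cr lti (ltnW ltj); have := corner_down cr lti ltj.
have := corner_step cr (ltnW lti) ltj; have := corner_step cr lti ltj.
have := corner_le cr lti ltj.
rewrite /row_label /col_label.
case: (tile_at P i j) => /= le ? ? ? ? [/esym El /esym Er /esym Et /esym Eb];
  rewrite ?El ?Er ?Et ?Eb //=.
- by congr (perm_at _ _, _); lia.
- rewrite /cross_step /=; have -> : r i.+1 j = (r i j).+1 by lia.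
  have ltr : (r i j).+1 < n by lia.
  have /= -> := tile_out_Crossing v ltr.
  by have -> : r i j.+1 = (r i j).+1 by lia.
- by congr (perm_at _ _, _); lia.
- by congr (_, perm_at _ _); lia.
Qed.

Lemma column_out_labels v j m : j < n -> m <= n ->
  column_out [seq tile_at P i j | i <- rev (iota 0 m)]
    [seq row_label v i j | i <- rev (iota 0 m)] (col_label v m j) =
  [seq row_label (foldl cross_step v (crossings_in_col j m)) i j.+1
     | i <- rev (iota 0 m)].
Proof.
move=> ltj; elim: m v => [|m IHm] v ltm //.
rewrite /crossings_in_col !rev_iotaS /= tile_out_labels //=.
set v1 := if _ then _ else _.
have -> : [seq (i, j) | i <- if tile_at P m j == Crossing
       then m :: [seq i <- rev (iota 0 m) | tile_at P i j == Crossing]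
       else [seq i <- rev (iota 0 m) | tile_at P i j == Crossing]] =
    (if tile_at P m j == Crossing then [:: (m, j)] else [::]) ++ crossings_in_col j m.
  by case: ifP.
have -> : foldl cross_step v ((if tile_at P m j == Crossing then [:: (m, j)] else [::])
   ++ crossings_in_col j m) = foldl cross_step v1 (crossings_in_col j m).
  by rewrite foldl_cat /v1; case: ifP.
(* A crossing in row m acts at positions r(m, j) and r(m, j) + 1, while the pipes on the left edges
   above it have positions below r(m, j). *)
have <- : [seq row_label v1 i j | i <- rev (iota 0 m)] =
          [seq row_label v i j | i <- rev (iota 0 m)].
  apply/eq_in_map => i; rewrite mem_rev mem_iota /= add0n => lti.
  rewrite /v1; case: eqP => // /crossingP[_ _ E]; rewrite /row_label /cross_step /=.
  case: ltnP => // ltr; have := corner_mono_row cr lti (ltnW ltm) (ltnW ltj).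
  have := corner_le cr ltm ltj => ? ?; by rewrite perm_at_step //; lia.
rewrite IHm 1?ltnW //; congr (_ :: _).
(* The crossings higher in this column act at positions below r(m, j + 1), so the label just output
   in row m is final for the column. *)
rewrite /row_label; case: ltnP => // _; rewrite perm_at_foldl // => -[i j'].
rewrite mem_crossings_in_col /= => /and3P[lti /eqP-> /eqP/crossingP[_ _ E]].
have := corner_mono_row cr lti (ltnW ltm) ltj; have := corner_le cr (ltnW ltm) ltj.
by lia.
Qed.

(** Crossings in the first [j] columns act at positions below [j], so the label entering column [j]
    from below is still its initial one. *)
Lemma perm_at_crossings j : j < n ->
  perm_at (foldl cross_step 1%g (crossings j)) j = insub j.
Proof.
move=> ltj; rewrite perm_at_foldl.
  by rewrite (perm_atE _ (Ordinal ltj)) perm1 (valK (Ordinal ltj)).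
move=> [i k]; rewrite mem_crossings /= => /andP[ltk /eqP/crossingP[lti ltkn E]].
by have := corner_le cr lti ltkn; lia.
Qed.

Lemma demazure_labels_crossings : demazure_labels P =
  [seq Some (foldl cross_step 1%g (crossings n) i) | i <- enum 'I_n].
Proof.
(* The invariant of the sweep: the labels on vertical line [j], from bottom to top. *)
pose g j :=
  [seq row_label (foldl cross_step 1%g (crossings j)) i j | i <- rev (iota 0 n)].
have tilesE (j : 'I_n) : [seq P i j | i <- rev (enum 'I_n)] =
    [seq tile_at P i j | i <- rev (iota 0 n)].
  by rewrite -val_enum_ord -map_rev -map_comp; apply: eq_map => i /=; rewrite tile_atE.
rewrite /demazure_labels.
have -> : nseq n None = g 0.
  apply: (@eq_from_nth _ None); first by rewrite size_map size_rev size_iota size_nseq.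
  move=> k; rewrite size_nseq => ltk; rewrite nth_nseq ltk.
  rewrite (nth_map 0) ?size_rev ?size_iota // nth_rev ?size_iota // nth_iota; last by lia.
  by rewrite /row_label !(corner_left cr) //; lia.
rewrite (foldl_enum_ord (g := g)) => [|j].
  rewrite /g map_rev revK -val_enum_ord -map_comp; apply: eq_map => i /=.
  by rewrite /row_label !(corner_right cr) ?ltnSn ?perm_atE // ltnW.
rewrite tilesE {2}/g /= foldl_cat -column_out_labels //; congr (column_out _ _ _).
rewrite /col_label !(corner_bottom cr) ?ltnSn ?perm_at_crossings ?valK // ltnW //.
Qed.

End Labels.

(** * Comparison of the two reading words *)

Definition column_lt : rel (nat * nat) :=
  fun c c' => (c.2 < c'.2) || ((c.2 == c'.2) && (c'.1 < c.1)).

Lemma column_lt_irr : irreflexive column_lt.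
Proof. by move=> c; rewrite /column_lt !ltnn andbF. Qed.

Lemma column_le_total : total column_le.
Proof. by move=> [a b] [c d]; rewrite /column_le /=; lia. Qed.

Lemma column_le_trans : transitive column_le.
Proof. by move=> [a b] [c d] [e f]; rewrite /column_le /=; lia. Qed.

Lemma pairwise_crossings n (P : 'M[tile]_n) r j : corner_sum n r -> corner_of P r ->
  pairwise column_lt (crossings P j).
Proof.
move=> cr cP; elim: j => //= j IHj; rewrite pairwise_cat IHj /=; apply/andP; split.
  apply/allrelP => c c'; rewrite (mem_crossings cr cP) mem_crossings_in_col.
  by move=> /andP[lt _] /and3P[_ /eqP E _]; rewrite /column_lt E lt.
rewrite pairwise_map pairwise_filter //.
elim: {1}n => [|m IHm] //; rewrite rev_iotaS /= IHm andbT.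
by apply/allP => i; rewrite mem_rev mem_iota /column_lt /= eqxx add0n => ->; rewrite orbT.
Qed.

Lemma column_wordE (T : filling) :
  column_word T = [seq entry T c.1 c.2 | c <- sort column_le (domf T)].
Proof.
rewrite /column_word; set s := sort _ _.
have : {subset s <= domf T} by move=> c; rewrite mem_sort.
elim: s => //= -[a b] s IHs sT.
rewrite /entry /= in_fnd ?sT ?mem_head // => ab /=.
by rewrite IHs // => c cs; apply: sT; rewrite inE cs orbT.
Qed.

Lemma foldl_map_in (A : eqType) (B S : Type) (f : A -> B) (op : S -> A -> S)
    (op' : S -> B -> S) s z :
  (forall u c, c \in s -> op' u (f c) = op u c) ->
  foldl op' z (map f s) = foldl op z s.
Proof.
elim: s z => //= c s IHs z E; rewrite E ?mem_head // IHs // => u c' c's.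
by apply: E; rewrite inE c's orbT.
Qed.

Section Hecke.
Variables (n : nat) (P : 'M[tile]_n) (la : seq nat) (r : nat -> nat -> nat).
Hypotheses (HP : HBPD_of_shape la P) (cr : corner_sum n r) (cP : corner_of P r).

Let T := entry (Omega P).
Let eT : encodes n T r := Omega_encodes HP cr cP.

(* Inverse to [crossing_cell]: the entry paired with a crossing is [r + 1]. *)
Definition tableau_cell (c : nat * nat) : nat * nat :=
  (c.1 - (r c.1 c.2).+1, c.2 - (r c.1 c.2).+1).

Definition crossing_cell (c : nat * nat) : nat * nat :=
  (c.1 + T c.1 c.2, c.2 + T c.1 c.2).

(** With k = r(i, j), the bound r <= k holds at (i, j), but r(i+1, j+1) = k + 2 violates the next
    bound; so the encoding forces the entry k + 1. *)
Lemma entry_tableau_cell i j : tile_at P i j = Crossing ->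
  [/\ r i j < i, r i j < j & T (i - (r i j).+1) (j - (r i j).+1) = (r i j).+1].
Proof.
move=> C; have [lti ltj E] := crossingP cr cP C.
have := corner_le cr lti ltj; rewrite {}E => lt.
split; try lia; have [eT1 _] := eT.
set a := i - _; set b := j - _; set k := r i j in a b lt *.
have Ei : i = a + k.+1 by lia.
have Ej : j = b + k.+1 by lia.
apply/eqP; rewrite eqn_leq; apply/andP; split; last first.
  by rewrite eT1 -?Ei -?Ej //; lia.
rewrite leqNgt eT1; [|lia|lia].
rewrite (_ : a + k.+2 = i.+1); last by lia.
rewrite (_ : b + k.+2 = j.+1); last by lia.
by have [_ _ ->] := crossingP cr cP C; rewrite -ltnNge.
Qed.

Lemma crossing_of_entry a b : 0 < T a b ->
  tile_at P (a + T a b) (b + T a b) = Crossing /\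
  r (a + T a b) (b + T a b) = (T a b).-1.
Proof.
have [eT1 eT2] := eT => T0; have [lta ltb] := eT2 _ _ T0.
have := eT1 a b (T a b) lta ltb; have := eT1 a b (T a b).-1.
rewrite prednK // ltnn !addnS (corner_diag cr cP lta ltb) => E1 E2.
have {}E1 : r (a + T a b) (b + T a b) <= (T a b).-1 by rewrite -E1; lia.
move: E2; case: eqP => _; first by lia.
by case: eqP => C ltr; [split=> //; lia | lia].
Qed.

(** Within a column the lower cell has the smaller entry, so the two orders agree. For c = (a, b),
    c' = (a', b') with b < b', reversed orders give T(c) >= T(c') + (b' - b). Equality would put
    both crossings in one column and force a' > a, and then the decrease down the rows contradicts
    equality. So the entries differ by at least two. *)
Lemma Omega_crossings_commute c c' : 0 < T c.1 c.2 -> 0 < T c'.1 c'.2 -> c != c' ->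
  column_le c c' ->
  column_lt (crossing_cell c') (crossing_cell c) ->
  ((T c.1 c.2).+1 < T c'.1 c'.2) || ((T c'.1 c'.2).+1 < T c.1 c.2).
Proof.
have dT := encodes_decreasing cr eT.
case: c c' => [a b] [a' b'] /=; rewrite xpair_eqE /column_le /column_lt /= => T0 T0'.
have := @decreasing_se T a b a' b' dT; have := @decreasing_se T a' b' a b dT.
lia.
Qed.

Lemma foldl_column_word :
  foldl (@hecke_step n) 1%g (column_word (Omega P)) =
  foldl (@cross_step n r) 1%g (crossings P n).
Proof.
have domE a b : ((a, b) \in blanks P) = (0 < T a b).
  by rewrite /T (entry_gt0 HP cr cP); case: HP => _ _ ->.
have cellK : {in crossings P n, cancel tableau_cell crossing_cell}.
  move=> [i j]; rewrite (mem_crossings cr cP) /= => /andP[_ /eqP C].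
  by rewrite /crossing_cell /=; have [? ? ->] := entry_tableau_cell C; congr (_, _); lia.
pose op v c := hecke_step v (T c.1 c.2) : 'S_n.
have <- : foldl op 1%g (map tableau_cell (crossings P n)) =
          foldl (@cross_step n r) 1%g (crossings P n).
  apply: foldl_map_in => u [i j]; rewrite (mem_crossings cr cP) => /andP[_ /eqP C].
  by have [_ _ E] := entry_tableau_cell C; rewrite /op /= E.
rewrite column_wordE (foldl_map_in (op := op)) //.
(* Both words are indexed by tableau cells: [e1] is the reading order, [e2] the order in which the
   paired crossings are met. *)
apply: (foldl_reorder (e1 := column_le) (e2 := relpre crossing_cell column_lt)).
- apply: uniq_perm; first by rewrite sort_uniq fset_uniq.
    rewrite map_inj_in_uniq; first exact: pairwise_uniq column_lt_irr
      (pairwise_crossings n cr cP).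
    by apply: can_in_inj cellK.
  move=> [a b]; rewrite mem_sort; apply/idP/mapP => [|[[i j] + ->]].
    rewrite domE => T0.
    have [C E] := crossing_of_entry T0; exists (a + T a b, b + T a b).
      by rewrite (mem_crossings cr cP) /= C eqxx; have [_ /(_ a b T0)[_ ->]] := eT.
    by rewrite /tableau_cell /= E prednK // !addnK.
  rewrite (mem_crossings cr cP) /= => /andP[_ /eqP C].
  by rewrite domE; have [_ _ ->] := entry_tableau_cell C.
- by rewrite sort_uniq fset_uniq.
- by rewrite -sorted_pairwise ?sort_sorted //;
    [exact: column_le_total | exact: column_le_trans].
- rewrite pairwise_map; apply: (@sub_in_pairwise _ (mem (crossings P n)))
    (pairwise_crossings n cr cP).
    by move=> c c' /cellK Ec /cellK Ec'; rewrite -{1}Ec -{1}Ec'.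
  exact/allP.
move=> [a b] [a' b']; rewrite !mem_sort !domE => T0 T0' ne le lt u.
have [_ eT2] := eT; apply: hecke_stepC => /=.
- by have := eT2 a b T0; rewrite -/T; lia.
- by have := eT2 a' b' T0'; rewrite -/T; lia.
exact: Omega_crossings_commute le lt.
Qed.
End Hecke.

Lemma Omega_hecke_word n (w : 'S_n) (P : 'M[tile]_n) :
  HBPD P -> in_Pipes w P -> hecke_word w (column_word (Omega P)).
Proof.
move=> [la HP] [bP]; have cr := corner_sumP bP; have cP := corner_ofP bP.
rewrite (demazure_labels_crossings cr cP) => Ew.
have wE : foldl (@cross_step n (corner P)) 1%g (crossings P n) = w.
  by apply/permP => i; have /eq_in_map/(_ i (mem_enum _ i))[] := Ew.
split; last by rewrite demazure_wordE (foldl_column_word HP cr cP) wE.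
have [_ eT] := Omega_encodes HP cr cP.
rewrite column_wordE all_map; apply/allP => -[a b]; rewrite mem_sort => D.
have T0 : 0 < entry (Omega P) a b.
  by rewrite (entry_gt0 HP cr cP); case: HP => _ _ Ela; have := Ela (a, b); rewrite D.
by have := eT a b T0; rewrite /= T0; lia.
Qed.

Theorem theorem1p7 (n : nat) (hn : 1 <= n) :
  [/\ forall P : 'M[tile]_n, HBPD P -> DT n.-1 (Omega P),
      forall (la : seq nat) (P : 'M[tile]_n),
        HBPD_of_shape la P -> dec_tableau_of_shape la (Omega P),
      forall P Q : 'M[tile]_n, HBPD P -> HBPD Q -> Omega P = Omega Q -> P = Q,
      forall T : filling, DT n.-1 T ->
        exists P : 'M[tile]_n, HBPD P /\ Omega P = T
    & forall (w : 'S_n) (P : 'M[tile]_n),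
        HBPD P -> in_Pipes w P -> hecke_word w (column_word (Omega P))].
Proof.
split.
- exact: Omega_DT.
- by move=> la P; apply: Omega_tableau.
- exact: Omega_inj.
- by move=> T; apply: Omega_surj.
- exact: Omega_hecke_word.
Qed.
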